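(* The 8-element set $\{0,1,4,5,8,9,12,13\}$ is extreme in $\mathbb Z_{16}$, even though it is not equivalent to a coset of $\{0,2,4,6,8,10,12,14\}$.
   Context: $\mathbb Z_n$ denotes the cyclic group of order $n$. For a finite abelian group $G$ with dual group $\Gamma$ and a complex measure $\mu$ on $G$: $\|\mu\|=\sum_{x\in G}|\mu(\{x\})|$, $\widehat\mu(\gamma)=\sum_{x\in G}\overline{\gamma(x)}\,\mu(\{x\})$ for $\gamma\in\Gamma$, and $\|\widehat\mu\|_\infty=\max_\gamma|\widehat\mu(\gamma)|$. A non-zero measure $\mu$ on $G$ is extreme if $\|\widehat\mu\|_\infty=\|\mu\|/\sqrt{\#\mathrm{supp}\,\mu}$. A set $E\subset G$ is extreme if it is the support of an extreme measure on $G$. Two subsets of $G$ are equivalent if one can be obtained from the other by a sequence of group automorphisms of $G$ and translations. *)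

(* Defs.v *)
From HB Require Import structures.
From mathcomp Require Import all_boot all_order all_algebra.
From mathcomp Require Import complex.
From mathcomp Require Import classical_sets reals.

Set Implicit Arguments.
Unset Strict Implicit.
Unset Printing Implicit Defensive.

Import Order.TTheory GRing.Theory Num.Theory.

Local Open Scope ring_scope.
Local Open Scope complex_scope.

(* A complex measure on the finite group G is encoded by its values on the
   points: mu x is the mass of {x}. *)

Definition measure_norm (R : realType) (G : finZmodType)
    (mu : {ffun G -> R[i]}) : R :=
  \sum_(x : G) Normc.normc (mu x).

Definition measure_supp (R : realType) (G : finZmodType)
    (mu : {ffun G -> R[i]}) : {set G} :=
  [set x | mu x != 0]%SET.

Definition dual_group (R : realType) (G : finZmodType) : set (G -> R[i]) :=
  [set gamma : G -> R[i] | {morph gamma : x y / x + y >-> x * y}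
                           /\ (forall x, Normc.normc (gamma x) = 1)]%classic.

Definition fourier (R : realType) (G : finZmodType)
    (mu : {ffun G -> R[i]}) (gamma : G -> R[i]) : R[i] :=
  \sum_(x : G) (gamma x)^* * mu x.

(* The dual group is finite and nonempty, so this supremum is a maximum. *)
Definition fourier_norm (R : realType) (G : finZmodType)
    (mu : {ffun G -> R[i]}) : R :=
  sup [set Normc.normc (fourier mu gamma) | gamma in @dual_group R G]%classic.

Definition extreme_measure (R : realType) (G : finZmodType)
    (mu : {ffun G -> R[i]}) : Prop :=
  mu != 0
  /\ fourier_norm mu = measure_norm mu / Num.sqrt (#|measure_supp mu|%:R).

Definition extreme_set (R : realType) (G : finZmodType) (E : {set G}) : Prop :=
  exists2 mu : {ffun G -> R[i]}, extreme_measure mu & measure_supp mu = E.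

Definition translate (G : finZmodType) (a : G) (A : {set G}) : {set G} :=
  [set a + x | x in A]%SET.

Inductive equivalent_sets (G : finZmodType) (A : {set G}) : {set G} -> Prop :=
| equivalent_refl : equivalent_sets A A
| equivalent_aut (B : {set G}) (f : {additive G -> G}) :
    equivalent_sets A B -> bijective f -> equivalent_sets A (f @: B)%SET
| equivalent_translate (B : {set G}) (a : G) :
    equivalent_sets A B -> equivalent_sets A (translate a B).

(* Main.v *)
Require Import Defs.
From HB Require Import structures.
From mathcomp Require Import all_boot all_order all_algebra.
From mathcomp Require Import complex.
From mathcomp Require Import classical_sets reals.
From mathcomp Require Import ring.

(** Extremality. Parseval and Cauchy-Schwarz make a measure extreme exactly
    when its modulus is constant on its support and its transform has constant
    modulus ([extreme_measure_of_flat] is the sufficiency, with modulus 1 on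
    the support).  The set is the union of H = {0, 4, 8, 12} and H + 1, so a
    measure carried by it has a transform of the form F(w^4) + w G(w^4), where
    w^16 = 1.  If F and G never overlap, the modulus
    of the transform is that of F or of G.  The weights f(4x) = 1, -i, 1, -i
    on H and g(4x+1) = i^x f(4x) = 1, 1, -1, -1 on H + 1 achieve this: F
    vanishes when w^8 = -1, G vanishes when w^8 = 1, and the surviving term has
    squared modulus 8 ([flat_root16]).

    Inequivalence. Translations and automorphisms preserve the existence of two
    points whose difference is not annihilated by 8
    ([equivalent_sets_exponent]).  The given set contains 0 and 1, whereas all
    differences in a coset of the even residues are even. *)

Import Order.TTheory GRing.Theory Num.Theory.

Local Open Scope ring_scope.

(** * Characters and flat measures *)

Section Flat.
Local Open Scope complex_scope.
Variables (R : realType) (G : finZmodType).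
Implicit Types (mu : {ffun G -> R[i]}) (gamma : G -> R[i]).

Lemma trivial_character : @dual_group R G (fun=> 1).
Proof.
split=> [x y|x]; first by rewrite mulr1.
by rewrite /= expr0n expr1n addr0 sqrtr1.
Qed.

Lemma character0 gamma : @dual_group R G gamma -> gamma 0 = 1.
Proof.
case=> gammaD gamma1; have g0 : gamma 0 != 0.
  by apply: contraPneq (gamma1 0) => ->; rewrite Normc.normc0 => /esym/eqP;
     rewrite oner_eq0.
by apply: (mulfI g0); rewrite -gammaD addr0 mulr1.
Qed.

Lemma characterMn gamma x n :
  @dual_group R G gamma -> gamma (x *+ n) = gamma x ^+ n.
Proof.
move=> Ggamma; elim: n => [|n IHn]; first by rewrite mulr0n character0.
by rewrite mulrS exprS Ggamma.1 IHn.
Qed.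

Lemma fourier_norm_const mu (c : R) :
    (forall gamma, @dual_group R G gamma -> Normc.normc (fourier mu gamma) = c) ->
  fourier_norm mu = c.
Proof.
move=> mu_c; rewrite /fourier_norm.
suff -> : [set Normc.normc (fourier mu gamma) | gamma in @dual_group R G]%classic
          = [set c]%classic by rewrite sup1.
apply/seteqP; split=> [r [gamma Ggamma <-]|r ->]; first exact: mu_c.
by exists (fun=> 1); [exact: trivial_character | exact/mu_c/trivial_character].
Qed.

(** The norm of [mu] is the size n of its support, and n / sqrt n = sqrt n. *)
Lemma extreme_measure_of_flat mu :
    mu != 0 ->
    (forall x, x \in measure_supp mu -> Normc.normc (mu x) = 1) ->
    (forall gamma, @dual_group R G gamma ->
       Normc.normc (fourier mu gamma) = Num.sqrt #|measure_supp mu|%:R) ->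
  extreme_measure mu.
Proof.
move=> mu0 mu1 mu_flat; split=> //; rewrite (fourier_norm_const _ _ mu_flat).
have -> : measure_norm mu = #|measure_supp mu|%:R.
  rewrite /measure_norm (bigID (mem (measure_supp mu))) /=.
  rewrite [X in _ + X]big1 => [|x]; last first.
    by rewrite inE negbK => /eqP->; exact: Normc.normc0.
  by rewrite addr0 (eq_bigr _ mu1) sumr_const.
have [->|n_gt0] := posnP #|measure_supp mu|; first by rewrite sqrtr0 mul0r.
have sn0 : Num.sqrt #|measure_supp mu|%:R != 0 :> R.
  by rewrite sqrtr_eq0 -ltNge ltr0n.
by apply: (mulIf sn0); rewrite divfK // -expr2 sqr_sqrtr.
Qed.

End Flat.

(** * Cyclic groups *)

Section Cyclic.
Local Open Scope complex_scope.
Variables (R : realType) (p : nat).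

Lemma sum_Zp (V : nmodType) (F : nat -> V) :
  (1 < p)%N -> \sum_(x : 'Z_p) F (val x) = \sum_(0 <= i < p) F i.
Proof. by move=> p_gt1; rewrite -[in RHS](Zp_cast p_gt1) big_mkord. Qed.

Lemma character_Zp_root (gamma : 'Z_p -> R[i]) :
  (1 < p)%N -> @dual_group R 'Z_p gamma -> gamma 1 ^+ p = 1.
Proof. by move=> p_gt1 Gg; rewrite -characterMn // pchar_Zp // character0. Qed.

(** A character of Z_p is determined by its value at 1, so the transform is a
    polynomial evaluated at a root of unity. *)
Lemma fourier_Zp (s : seq R[i]) (gamma : 'Z_p -> R[i]) :
    (1 < p)%N -> @dual_group R 'Z_p gamma ->
  fourier [ffun x : 'Z_p => s`_(val x)] gamma
  = \sum_(0 <= i < p) (gamma 1)^* ^+ i * s`_i.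
Proof.
move=> p_gt1 Gg; rewrite -sum_Zp //; apply: eq_bigr => x _; rewrite ffunE.
by congr (_ * _); rewrite -{1}[x]natr_Zp characterMn // rmorphXn.
Qed.

End Cyclic.

(** * An invariant of equivalence *)

(** The difference is fixed by translations, and an automorphism preserves the
    order of an element. *)
Lemma equivalent_sets_exponent (G : finZmodType) (n : nat) (A B : {set G}) :
    equivalent_sets A B ->
    (exists x y, [/\ x \in A, y \in A & (x - y) *+ n != 0]) ->
  exists x y, [/\ x \in B, y \in B & (x - y) *+ n != 0].
Proof.
move=> eqAB exA; elim: B / eqAB => // [B f _ [x [y [Bx By xy]]] bij_f|].
  exists (f x), (f y); split; [exact: imset_f | exact: imset_f |].
  by rewrite -raddfB -raddfMn raddf_eq0 //; exact: bij_inj.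
move=> B a _ [x [y [Bx By xy]]].
exists (a + x), (a + y); split; [exact: imset_f | exact: imset_f |].
by rewrite opprD addrACA subrr add0r.
Qed.

(** * The flat measure on Z_16 *)

Section Z16.
Local Open Scope complex_scope.
Variable R : realType.

(** On H = {0, 4, 8, 12} the weights 1, -i, 1, -i repeat with period 2, so
    their transform is carried by the even frequencies; on H + 1 they are
    multiplied by the character i^x, which moves it to the odd frequencies. *)
Definition weights : seq R[i] :=
  [:: 1; 1; 0; 0; - 'i; 1; 0; 0; 1; -1; 0; 0; - 'i; -1; 0; 0].

Definition flat_measure : {ffun 'Z_16 -> R[i]} := [ffun x => weights`_(val x)].

(** Membership tested on naturals, which, unlike sums of 1 in Z_16, compute
    at once. *)
Lemma in_two_cosets (x : 'Z_16) :
  (x \in [set 0; 1; 4; 5; 8; 9; 12; 13]%SET)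
  = (val x \in [:: 0; 1; 4; 5; 8; 9; 12; 13]%N).
Proof. by rewrite !inE -!orbA -!val_eqE. Qed.

Lemma supp_flat_measure :
  measure_supp flat_measure = [set 0; 1; 4; 5; 8; 9; 12; 13]%SET.
Proof.
have i0 : - 'i != 0 :> R[i] by rewrite oppr_eq0 eq_complex /= oner_eq0 andbF.
apply/setP => x; rewrite in_two_cosets !inE ffunE.
by case: x => -[|[|[|[|[|[|[|[|[|[|[|[|[|[|[|[|m]]]]]]]]]]]]]]]] //= ?;
   rewrite ?oppr_eq0 ?oner_eq0 ?eqxx ?i0.
Qed.

Lemma card_supp_flat_measure : #|measure_supp flat_measure| = 8.
Proof.
rewrite supp_flat_measure -sum1_card (eq_bigl _ _ in_two_cosets) big_mkcond.
rewrite (@sum_Zp 16 nat (fun i => if i \in [:: 0; 1; 4; 5; 8; 9; 12; 13]%N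
                               then 1%N else 0%N)) //.
by rewrite unlock.
Qed.

Lemma normc_flat_measure x :
  x \in measure_supp flat_measure -> Normc.normc (flat_measure x) = 1.
Proof.
rewrite inE ffunE.
by case: x => -[|[|[|[|[|[|[|[|[|[|[|[|[|[|[|[|m]]]]]]]]]]]]]]]] //= ?;
  rewrite ?eqxx // => _; rewrite ?oppr0 ?sqrrN ?expr0n ?expr1n ?addr0 ?add0r sqrtr1.
Qed.

(** Since w^8 = 1 or w^8 = -1, exactly one summand survives; then w^4 is
    respectively 1, -1 or 'i, - 'i, and the remaining factor has modulus
    2 sqrt 2. *)
Lemma flat_root16 (w : R[i]) :
  Normc.normc w = 1 -> w ^+ 16 = 1 ->
  Normc.normc ((1 + w ^+ 8) * (1 - 'i * w ^+ 4)
               + w * ((1 - w ^+ 8) * (1 + w ^+ 4))) = Num.sqrt 8%:R.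
Proof.
move=> w1 w16.
have i2 : 'i ^+ 2 = -1 :> R[i] by exact: sqr_i.
have normcE (z : R[i]) (a b : R) : z = a +i* b -> a ^+ 2 + b ^+ 2 = 8%:R ->
  Normc.normc z = Num.sqrt 8%:R by move=> -> /= ->.
have: (w ^+ 8) ^+ 2 = 1 ^+ 2 by rewrite -exprM w16 expr1n.
move=> /eqP; rewrite eqf_sqr => /orP[/eqP w8|/eqP w8].
  have: (w ^+ 4) ^+ 2 = 1 ^+ 2 by rewrite -exprM w8 expr1n.
  rewrite w8 subrr mul0r mulr0 addr0 => /eqP; rewrite eqf_sqr => /orP[] /eqP ->.
    apply: (normcE _ 2 (- 2)); last by ring.
    by apply/eqP; rewrite eq_complex /=; apply/andP; split; apply/eqP; ring.
  apply: (normcE _ 2 2); last by ring.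
  by apply/eqP; rewrite eq_complex /=; apply/andP; split; apply/eqP; ring.
have: (w ^+ 4) ^+ 2 = 'i ^+ 2 by rewrite -exprM w8 i2.
rewrite w8 subrr mul0r add0r Normc.normcM w1 mul1r => /eqP.
rewrite eqf_sqr => /orP[] /eqP ->.
  apply: (normcE _ 2 2); last by ring.
  by apply/eqP; rewrite eq_complex /=; apply/andP; split; apply/eqP; ring.
apply: (normcE _ 2 (- 2)); last by ring.
by apply/eqP; rewrite eq_complex /=; apply/andP; split; apply/eqP; ring.
Qed.

Lemma fourier_flat_measure gamma : @dual_group R 'Z_16 gamma ->
  Normc.normc (fourier flat_measure gamma) = Num.sqrt 8%:R.
Proof.
move=> Ggamma; rewrite fourier_Zp // -(@flat_root16 (gamma 1)^*).
- by congr Normc.normc; rewrite unlock /=; ring.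
- by case: (gamma 1) (Ggamma.2 1) => a b /=; rewrite sqrrN.
- by rewrite -rmorphXn /= character_Zp_root // rmorph1.
Qed.

End Z16.

Theorem proposition4p15 (R : realType) :
  extreme_set R ([set 0; 1; 4; 5; 8; 9; 12; 13]%SET : {set 'Z_16})
  /\ ~ (exists a : 'Z_16,
          equivalent_sets
            ([set 0; 1; 4; 5; 8; 9; 12; 13]%SET : {set 'Z_16})
            (translate a
              ([set 0; 2; 4; 6; 8; 10; 12; 14]%SET : {set 'Z_16}))).
Proof.
split.
  exists (flat_measure R); last exact: supp_flat_measure.
  apply: extreme_measure_of_flat.
  - apply/eqP => mu0; have := card_supp_flat_measure R.
    by rewrite mu0 /measure_supp eq_card0 // => x; rewrite !inE ffunE eqxx.
  - exact: normc_flat_measure.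
  - by rewrite card_supp_flat_measure; exact: fourier_flat_measure.
case=> a /(equivalent_sets_exponent _ 8)[].
  by exists 1, 0; split; rewrite ?inE.
move=> _ [_ [/imsetP[x Ex ->] /imsetP[y Ey ->]]]; rewrite opprD addrACA subrr add0r.
have even_killed z : z \in [set 0; 2; 4; 6; 8; 10; 12; 14]%SET ->
    z *+ 8 = 0 :> 'Z_16.
  by rewrite !inE -!orbA => /or4P[|||/or4P[|||/orP[]]] /eqP ->; apply/eqP.
by rewrite mulrnBl (even_killed x Ex) (even_killed y Ey) subrr eqxx.
Qed.
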